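(* Let $G$ be a compact totally disconnected first countable (metrizable) group and let $T\in\mathrm{Aut}(G)$. Then the following are equivalent: (1) $T$ acts distally on $G$. (2) $T$ acts distally on $\mathrm{Sub}_G$. (3) $T$ is contained in a compact subgroup of $\mathrm{Aut}(G)$.
   Context: $\mathrm{Sub}_G$ is the compact space of all closed subgroups of $G$ with the Chabauty topology: a sub-basis is given by the sets $\{A\in\mathrm{Sub}_G\mid A\cap K=\emptyset\}$ ($K\subset G$ compact) and $\{A\in\mathrm{Sub}_G\mid A\cap U\ne\emptyset\}$ ($U\subset G$ open). $T\in\mathrm{Aut}(G)$ acts on $\mathrm{Sub}_G$ by $H\mapsto T(H)$. A homeomorphism $T$ of a Hausdorff space $X$ acts distally on $X$ if for all $x\ne y$ in $X$ the closure of $\{(T^n(x),T^n(y))\mid n\in\mathbb{Z}\}$ in $X\times X$ does not meet the diagonal. $\mathrm{Aut}(G)$ is the group of (bicontinuous) automorphisms of $G$, endowed with the compact-open topology. *)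

(* Defs.v *)
From HB Require Import structures.
From mathcomp Require Import all_boot all_order all_algebra finmap.
From mathcomp Require Import all_classical topology.

Set Implicit Arguments.
Unset Strict Implicit.
Unset Printing Implicit Defensive.

Local Open Scope classical_set_scope.
Local Open Scope group_scope.

HB.structure Definition PreTopologicalGroup :=
  {G of Topological G & Group G}.

HB.mixin Record PreTopologicalGroup_isTopologicalGroup G
    of PreTopologicalGroup G := {
  mulg_continuous : continuous (fun xy : G * G => xy.1 * xy.2);
  invg_continuous : continuous (fun x : G => x^-1)
}.

#[short(type="topologicalGroupType")]
HB.structure Definition TopologicalGroup :=
  {G of PreTopologicalGroup G & PreTopologicalGroup_isTopologicalGroup G}.

Definition first_countable (X : topologicalType) : Prop :=
  forall x : X, exists B : set (set X),
    [/\ countable B, B `<=` nbhs x &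
        forall U, nbhs x U -> exists2 V, B V & V `<=` U].

Definition is_subgroup (G : groupType) (A : set G) : Prop :=
  [/\ A 1, (forall x y, A x -> A y -> A (x * y)) & forall x, A x -> A x^-1].

(* The inverse is stored as data so that negative iterates are computable; it
   is determined by the map, see homeo_inj below. *)
Record homeomorphism (X : topologicalType) := Homeomorphism {
  homeo_fun :> X -> X;
  homeo_inv : X -> X;
  homeoK : cancel homeo_fun homeo_inv;
  homeoVK : cancel homeo_inv homeo_fun;
  homeo_continuous : continuous homeo_fun;
  homeo_inv_continuous : continuous homeo_inv
}.

Definition homeo_iter (X : topologicalType) (T : homeomorphism X) (n : int) :
    X -> X :=
  match n with
  | Posz k => iter k T
  | Negz k => iter k.+1 (homeo_inv T) (* Negz k is -(k + 1) *)
  end.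

(* Only meant for Hausdorff X. *)
Definition distal (X : topologicalType) (T : homeomorphism X) : Prop :=
  forall x y : X, x <> y ->
    closure [set z : X * X |
      exists n : int, z = (homeo_iter T n x, homeo_iter T n y)]
    `&` [set z | z.1 = z.2] = set0.

Lemma homeo_inj (X : topologicalType) (S T : homeomorphism X) :
  homeo_fun S = homeo_fun T -> S = T.
Proof.
case: S T => [f f' fK f'K cf cf'] [g g' gK g'K cg cg'] /= fg; subst g.
have fg' : f' = g' by apply/funext => x; apply: (can_inj fK); rewrite f'K g'K.
by subst g'; congr Homeomorphism; exact: Prop_irrelevance.
Qed.

Section TopAutGroup.
Variable G : topologicalGroupType.

Record topAut := TopAut {
  aut_homeo :> homeomorphism G;
  autM : {morph aut_homeo : x y / x * y}
}.

Lemma aut_inj (S T : topAut) : S =1 T -> S = T.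
Proof.
case: S T => [f fM] [g gM] /= /funext/homeo_inj fg; subst g.
by congr TopAut; exact: Prop_irrelevance.
Qed.

Lemma aut_invM (T : topAut) : {morph homeo_inv T : x y / x * y}.
Proof. by move=> x y; apply: (can_inj (homeoK T)); rewrite autM !homeoVK. Qed.

Definition aut1 : topAut :=
  @TopAut (@Homeomorphism G id id (fun=> erefl) (fun=> erefl)
            (fun=> cvg_id) (fun=> cvg_id))
         (fun _ _ => erefl).

Definition aut_inv (T : topAut) : topAut :=
  @TopAut (Homeomorphism (homeoVK T) (homeoK T)
            (@homeo_inv_continuous _ T) (@homeo_continuous _ T))
         (aut_invM T).

Lemma aut_mulM (S T : topAut) : {morph (S \o T) : x y / x * y}.
Proof. by move=> x y /=; rewrite !autM. Qed.

Lemma aut_mul_continuous (S T : topAut) : continuous (S \o T).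
Proof. by move=> x; apply: continuous_comp; exact: homeo_continuous. Qed.

Lemma aut_mul_inv_continuous (S T : topAut) :
  continuous (homeo_inv T \o homeo_inv S).
Proof. by move=> x; apply: continuous_comp; exact: homeo_inv_continuous. Qed.

Definition aut_mul (S T : topAut) : topAut :=
  @TopAut (Homeomorphism (can_comp (homeoK S) (homeoK T))
            (can_comp (homeoVK T) (homeoVK S))
            (@aut_mul_continuous S T) (@aut_mul_inv_continuous S T))
         (@aut_mulM S T).

HB.instance Definition _ := gen_eqMixin topAut.
HB.instance Definition _ := gen_choiceMixin topAut.

Let aut_mulA : associative aut_mul.
Proof. by move=> R S T; exact: aut_inj. Qed.
Let aut_mul1g : left_id aut1 aut_mul.
Proof. by move=> T; exact: aut_inj. Qed.
Let aut_mulg1 : right_id aut1 aut_mul.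
Proof. by move=> T; exact: aut_inj. Qed.
Let aut_mulVg : left_inverse aut1 aut_inv aut_mul.
Proof. by move=> T; apply: aut_inj => x /=; exact: homeoK. Qed.
Let aut_mulgV : right_inverse aut1 aut_inv aut_mul.
Proof. by move=> T; apply: aut_inj => x /=; exact: homeoVK. Qed.

HB.instance Definition _ :=
  isGroup.Build topAut aut_mulA aut_mul1g aut_mulg1 aut_mulVg aut_mulgV.

(* Subspace topology inherited from the compact-open topology on G -> G. *)
HB.instance Definition _ := Topological.copy topAut
  (initial_topology (fun T : topAut => (T : G -> G) : {compact-open, G -> G})).

End TopAutGroup.

Section Chabauty.
Variable G : topologicalGroupType.

Record closed_subgroup := ClosedSubgroup {
  sub_set :> set G;
  sub_subgroup : is_subgroup sub_set;
  sub_closed : closed sub_set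
}.

Lemma sub_inj (A B : closed_subgroup) : sub_set A = sub_set B -> A = B.
Proof.
case: A B => [A sA cA] [B sB cB] /= AB; subst B.
by congr ClosedSubgroup; exact: Prop_irrelevance.
Qed.

HB.instance Definition _ := gen_eqMixin closed_subgroup.
HB.instance Definition _ := gen_choiceMixin closed_subgroup.

Definition chabauty_subbase : set (set closed_subgroup) :=
  [set [set A : closed_subgroup | sub_set A `&` K = set0] |
     K in [set K : set G | compact K]]
  `|`
  [set [set A : closed_subgroup | sub_set A `&` U !=set0] |
     U in [set U : set G | open U]].

(* The Chabauty topology. *)
HB.instance Definition _ :=
  isSubBaseTopological.Build closed_subgroup chabauty_subbase id.

Lemma chabauty_open (W : set closed_subgroup) : chabauty_subbase W -> open W.
Proof.
move=> SW; exists [set W]; last by rewrite bigcup_set1.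
move=> _ ->; exists (fset1 W); last by rewrite set_fset1 bigcap_set1.
by move=> _ /[!inE] ->.
Qed.

Lemma continuous_chabauty (f : closed_subgroup -> closed_subgroup) :
  (forall W, chabauty_subbase W -> open (f @^-1` W)) -> continuous f.
Proof.
move=> fW; apply/continuousP => _ [D sD <-].
rewrite preimage_bigcup; apply: bigcup_open => W /sD [E sE <-].
rewrite openE => A AE; apply: filter_bigI => V VE.
have {fW} : open (f @^-1` V) by apply: fW; have := sE _ VE; rewrite inE.
by rewrite openE; apply; exact: AE.
Qed.

Section image.
Variable T : topAut G.

Lemma image_homeoE (A : set G) : T @` A = homeo_inv T @^-1` A.
Proof.
apply/seteqP; split=> [_ [x Ax <-]|x Ax]; first by rewrite /= homeoK.
by exists (homeo_inv T x) => //; exact: homeoVK.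
Qed.

Lemma sub_image_subgroup (A : closed_subgroup) : is_subgroup (T @` A).
Proof.
have T1 : homeo_inv T 1 = 1.
  by apply: (mulgI (homeo_inv T 1)); rewrite -aut_invM !mulg1.
rewrite image_homeoE; case: (sub_subgroup A) => A1 AM AV; split=> /=.
- by rewrite T1.
- by move=> x y Ax Ay; rewrite aut_invM; exact: AM.
- move=> x /AV; congr (sub_set A _); apply/esym.
  by apply: (mulgI (homeo_inv T x)); rewrite -aut_invM !mulgV.
Qed.

Lemma sub_image_closed (A : closed_subgroup) : closed (T @` A).
Proof.
rewrite image_homeoE; apply: preimage_closed; last exact: sub_closed.
by move=> x _; exact: homeo_inv_continuous.
Qed.

Definition sub_image (A : closed_subgroup) : closed_subgroup :=
  ClosedSubgroup (sub_image_subgroup A) (@sub_image_closed A).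

End image.

Lemma sub_imageK (T : topAut G) : cancel (sub_image T) (sub_image T^-1).
Proof.
move=> A; apply: sub_inj.
transitivity (homeo_inv T^-1 @^-1` (homeo_inv T @^-1` A)).
  by rewrite -!image_homeoE.
by apply/funext => x; rewrite /preimage /= (homeoK T).
Qed.

Lemma sub_imageVK (T : topAut G) : cancel (sub_image T^-1) (sub_image T).
Proof. by move=> A; rewrite -{1}(invgK T); exact: sub_imageK. Qed.

Lemma sub_image_continuous (T : topAut G) : continuous (sub_image T).
Proof.
have TI (A B : set G) : T @` A `&` B = T @` (A `&` homeo_inv T @` B).
  rewrite [homeo_inv T @` B](@image_homeoE T^-1) !image_homeoE.
  by apply/seteqP; split=> x; rewrite /= homeoVK.
apply: continuous_chabauty => _ [[K cK <-]|[U oU <-]]; apply: chabauty_open.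
- left; exists (homeo_inv T @` K).
    apply: continuous_compact cK; apply: continuous_subspaceT.
    exact: homeo_inv_continuous.
  apply/seteqP; split=> A; rewrite /preimage /= TI => H.
    by rewrite H image_set0.
  by move: H; exact: image_set0_set0.
- right; exists (homeo_inv T @` U).
    rewrite /= [homeo_inv T @` U](@image_homeoE T^-1).
    by move/continuousP: (@homeo_continuous _ T); exact.
  apply/seteqP; split=> A; rewrite /preimage /= TI.
    by case=> x ?; exists (T x), x.
  by case=> _ [x ? _]; exists x.
Qed.

(* The action of T on the space of closed subgroups, H |-> T(H). *)
Definition sub_homeo (T : topAut G) : homeomorphism closed_subgroup :=
  Homeomorphism (sub_imageK T) (sub_imageVK T)
    (@sub_image_continuous T) (@sub_image_continuous T^-1).

End Chabauty.

(* Main.v *)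
(* The link between the three properties is that [T] is distal on [G] iff the
   open subgroups [V] with [T V = V] form a base of neighborhoods of 1.

   Given that base, two closed subgroups [A <> B] satisfy [AV <> BV] for some
   such [V]; since [T^n A V = T^n (A V)] and since the subgroups [D] with
   [D V = C V] form a Chabauty neighborhood of [C], their orbits stay apart,
   which is (2).  The automorphisms preserving all these [V] form an
   equicontinuous, compact subgroup, which is (3).  Conversely (2) implies (1)
   because small elements of a profinite group generate small closed subgroups,
   and (3) implies (1) by taking a cluster point of the iterates of [T].

   The base is obtained from Ellis's theorem: for a distal map [f] of a compact
   Hausdorff space, the identity is a pointwise limit of the iterates [f^n],
   [n >= 1], so that every point is recurrent. *)
Require Import Defs.
From mathcomp Require Import all_boot all_order all_algebra finmap.
From mathcomp Require Import all_classical topology.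

Set Implicit Arguments.
Unset Strict Implicit.
Unset Printing Implicit Defensive.

Local Open Scope classical_set_scope.

(** * Clopen neighborhoods in compact Hausdorff spaces *)

Section CompactSpaces.
Variable X : topologicalType.
Hypothesis X_compact : compact [set: X].

Lemma closed_compact (A : set X) : closed A -> compact A.
Proof. by move=> cA; exact: (subclosed_compact cA X_compact). Qed.

(** Otherwise the sets [D] minus [U] generate a proper filter; by compactness it clusters at a point
    lying in every closed [D] but outside [U]. *)
Lemma compact_directed_sub_open (B : set (set X)) (U : set X) :
  B !=set0 -> (forall D E, B D -> B E -> exists2 F, B F & F `<=` D `&` E) ->
  (forall D, B D -> closed D) -> open U ->
  \bigcap_(D in B) D `<=` U -> exists2 D, B D & D `<=` U.
Proof.
move=> [D0 BD0] Bdir Bcl oU BU; apply: contrapT => nBU.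
pose F := filter_from B (fun D => D `&` ~` U).
have FF : ProperFilter F.
  apply: filter_from_proper => [|D BD]; last first.
    apply: contrapT => DU0; apply: nBU; exists D => // x Dx.
    by apply: contrapT => nUx; apply: DU0; exists x.
  apply: filter_from_filter; first by exists D0.
  move=> D E BD BE; have [K BK KDE] := Bdir _ _ BD BE.
  by exists K => // x [/KDE[Dx Ex] Ux].
have [x [_ Fx]] : [set: X] `&` cluster F !=set0.
  by apply: X_compact; exact: filterT.
have clx (K D : set X) : closed K -> B D -> D `&` ~` U `<=` K -> K x.
  move=> cK BD DK; apply: cK => W Wx.
  by have [|y [Ky Wy]] := Fx K W _ Wx; [exists D|exists y].
apply: (clx (~` U) D0) => //; first exact: open_closedC.
by apply: BU => D BD; apply: (clx D D); [exact: Bcl| |move=> ? []].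
Qed.

Hypothesis X_hausdorff : hausdorff_space X.

Definition quasi_component (x : X) :=
  \bigcap_(D in [set D : set X | D x /\ clopen D]) D.

Lemma quasi_component_sub_open (x : X) (U : set X) :
  open U -> quasi_component x `<=` U ->
  exists2 D : set X, D x /\ clopen D & D `<=` U.
Proof.
move=> oU QU; apply: compact_directed_sub_open => //.
- by exists setT; split => //; exact: clopenT.
- move=> A B [? ?] [? ?]; exists (A `&` B) => //.
  by split=> //; exact: clopenI.
- by move=> D [_ []].
Qed.

(** Normality gives an open [W] around [A] whose closure misses [B], and some clopen [D] around [x]
    avoids the boundary of [W]. The trace of [D] on [W] is then clopen, so it contains the
    quasi-component. *)
Lemma quasi_component_sub_left (x : X) (A B : set X) :
  closed A -> closed B -> A `&` B = set0 -> A x ->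
  quasi_component x `<=` A `|` B -> quasi_component x `<=` A.
Proof.
move=> cA cB AB0 Ax QAB.
have BA : B `<=` ~` A by move=> z Bz Az; rewrite -[False]/(set0 z) -AB0.
have [V /set_nbhsP[W [oW AW WV]] VB] : filter_from (set_nbhs A) closure (~` B).
  apply: compact_normal => // z Az.
  apply: open_nbhs_nbhs; split; first exact: closed_openC.
  by move=> Bz; exact: (BA z).
have [D [Dx [oD cD]] DWB] :
    exists2 D : set X, D x /\ clopen D & D `<=` W `|` ~` closure W.
  apply: quasi_component_sub_open.
    by apply: openU => //; exact/closed_openC/closed_closure.
  move=> z /QAB[/AW|Bz]; [by left|right => cWz].
  by apply: (VB z) => //; exact: closureS cWz.
have QW : quasi_component x `<=` W.
  suff DWc : clopen (D `&` W).
    by move=> z /(_ (D `&` W))[] //; split => //; split => //; exact: AW.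
  split; first exact: openI.
  suff -> : D `&` W = D `&` closure W.
    by apply: closedI => //; exact: closed_closure.
  apply/seteqP; split => z [Dz Wz]; split => //; first exact: subset_closure.
  by have [] := DWB _ Dz.
move=> z Qz; have [//|Bz] := QAB _ Qz; exfalso.
by apply: (VB z) => //; exact/subset_closure/WV/QW.
Qed.

Lemma quasi_component_refl (x : X) : quasi_component x x.
Proof. by move=> D []. Qed.

(** A relatively clopen piece of [Q] and its complement in [Q] are both closed in [X], and the one
    containing [x] is all of [Q]. *)
Lemma quasi_component_connected (x : X) : connected (quasi_component x).
Proof.
set Q := quasi_component x.
have cQ : closed Q by apply: closed_bigI => D [_ []].
move=> B [b Bb] [O oO BO] [C cC BC].
have cB : closed B by rewrite BC; exact: closedI.
have cQO : closed (Q `&` ~` O) by apply: closedI => //; exact: open_closedC.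
have BO0 : B `&` (Q `&` ~` O) = set0.
  by rewrite -subset0 BO => z [[_ Oz] [_ /(_ Oz)]].
have QBO : Q `<=` B `|` (Q `&` ~` O).
  by move=> z Qz; have [Oz|Oz] := pselect (O z); [left; rewrite BO|right].
apply/seteqP; split; first by rewrite BO => z [].
have [Bx|nBx] := pselect (B x); first exact: quasi_component_sub_left QBO.
have : Q `<=` Q `&` ~` O.
  apply: (@quasi_component_sub_left _ _ B) => //.
  - by rewrite setIC.
  - by case: (QBO x (@quasi_component_refl x)).
  - by rewrite setUC.
by move: Bb; rewrite BO => -[Qb Ob] /(_ b Qb)[_ /(_ Ob)].
Qed.

Lemma totally_disconnected_clopen_base (x : X) (U : set X) :
  totally_disconnected [set: X] -> nbhs x U ->
  exists2 D : set X, D x /\ clopen D & D `<=` U.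
Proof.
move=> tdX; rewrite nbhsE => -[V [oV Vx] VU].
have [|D Dx DV] := @quasi_component_sub_open x V oV.
  move=> y Qy; suff -> : y = x by [].
  rewrite -[y = x]/([set x] y) -(tdX x I).
  exists (quasi_component x) => //; split => //.
  - exact: quasi_component_refl.
  - exact: quasi_component_connected.
by exists D => //; exact: subset_trans VU.
Qed.

End CompactSpaces.

(** * Idempotents in compact right topological semigroups *)

Section EllisNumakura.
Variables (Y : topologicalType) (m : Y -> Y -> Y).
Hypotheses (Y_compact : compact [set: Y]) (Y_hausdorff : hausdorff_space Y).
Hypotheses (mA : associative m) (m_continuous : forall u, continuous (m^~ u)).

Let subsemigroup (S : set Y) :=
  [/\ closed S, S !=set0 & forall p q, S p -> S q -> S (m p q)].

(** Zorn's lemma for unions, applied to complements in [E]; compactness keeps the intersection of a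
    chain nonempty. *)
Lemma ellis_minimal (E : set Y) : subsemigroup E ->
  exists S, [/\ subsemigroup S, S `<=` E &
    forall S', subsemigroup S' -> S' `<=` S -> S `<=` S'].
Proof.
move=> sE; have [cE E0 Em] := sE.
have [|A [sA Amax]] := @Zorn_bigcup Y [set A | subsemigroup (~` A `&` E)].
  move=> F FP Ftot /=.
  (* [E] is added so that the family is nonempty even for an empty chain. *)
  pose B := E |` [set ~` A `&` E | A in F].
  have sB D : B D -> subsemigroup D by move=> [->//|[A FA <-]]; exact: FP.
  have BE D : B D -> D `<=` E by move=> [->//|[A FA <-] x []].
  have -> : ~` (\bigcup_(A in F) A) `&` E = \bigcap_(D in B) D.
    apply/seteqP; split=> [x [nFx Ex] _ [->//|[A FA <-]]|x Bx].
      by split => // Ax; apply: nFx; exists A.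
    split; last by apply: Bx; left.
    move=> [A FA Ax]; have [|/(_ Ax)//] := Bx (~` A `&` E).
    by right; exists A.
  split.
  - by apply: closed_bigI => D /sB[].
  - apply: contrapT => /set0P/negP; rewrite negbK => /eqP B0.
    have [|D D'|D /sB[]||D /sB[_ [x Dx] _] /(_ x Dx)] // :=
      compact_directed_sub_open Y_compact (B := B) (U := set0) _ _ _ open0 _.
    + by exists E; left.
    + move=> [->|[A FA <-]] [->|[A' FA' <-]].
      * by exists E; [left|rewrite setIid].
      * by exists (~` A' `&` E); [right; exists A'|move=> x []].
      * by exists (~` A `&` E); [right; exists A|move=> x []].
      * have [AA'|A'A] := Ftot _ _ FA FA'.
        - exists (~` A' `&` E); first by right; exists A'.
          by move=> x [nA' Ex]; split; split => // /AA'.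
        - exists (~` A `&` E); first by right; exists A.
          by move=> x [nA Ex]; split; split => // /A'A.
    + by rewrite B0.
  - move=> p q Bp Bq D BD; have [_ _] := sB _ BD; apply; [exact: Bp|exact: Bq].
exists (~` A `&` E); split => // S' sS' S'A x [nAx Ex].
have S'E : S' `<=` E by move=> y /S'A[].
apply: contrapT => nS'x; apply: (Amax (~` S')); last first.
  by rewrite /= setCK setIidl.
by split => [y Ay /S'A[]|/(_ x nS'x)].
Qed.

(** For [u] in a minimal [S], the closed subsemigroup [S u] is all of [S], so [v u = u] for some [v]
    in [S]. The elements [p] of [S] with [p u = u] then form a closed subsemigroup, again all of
    [S], which thus contains [u]. *)
Lemma ellis_numakura (E : set Y) :
  closed E -> E !=set0 -> (forall p q, E p -> E q -> E (m p q)) ->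
  exists2 u, E u & m u u = u.
Proof.
move=> cE E0 Em; have [|S [[cS [u Su] Sm] SE Smin]] := @ellis_minimal E.
  by split.
exists u; first exact: SE.
have [||v Sv vu] := Smin (m^~ u @` S) _ _ u Su; last first.
  pose B := S `&` [set p | m p u = u].
  have [||//] := Smin B _ _ u Su; last by move=> p [].
  split; last 1 first.
  - move=> p q [Sp pu] [Sq qu]; split; first exact: (Sm).
    by rewrite /= -mA qu pu.
  - apply: closedI => //; apply: (@preimage_closed _ _ (m^~ u) [set u]).
      by move=> p _; exact: m_continuous.
    exact/accessible_closed_set1/hausdorff_accessible.
  - by exists v.
- by move=> _ [p Sp <-]; exact: (Sm).
split; last 1 first.
- move=> _ _ [p Sp <-] [q Sq <-]; exists (m (m p u) q); last by rewrite !mA.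
  by apply: (Sm) => //; exact: (Sm).
- apply: compact_closed => //; apply: continuous_compact.
    by apply: continuous_subspaceT; exact: m_continuous.
  exact: closed_compact.
- by exists (m u u), u.
Qed.

End EllisNumakura.

(** * Pointwise limits of iterates and recurrence *)

Lemma eval_ptws_continuous (X Y : topologicalType) (x : X) :
  continuous (fun p : {ptws X -> Y} => p x).
Proof. exact: (@proj_continuous X (fun=> Y) x). Qed.

Lemma ptws_continuous (X Y Z : topologicalType) (f : Z -> {ptws X -> Y}) :
  (forall x, continuous (fun z => f z x)) -> continuous f.
Proof.
move=> fx z; apply/cvg_sup => x U.
move=> [_ [[V oV <-] Vfz] VU].
suff : nbhs z ((fun z => f z x) @^-1` V) by apply: filterS => w; exact: VU.
by apply: fx; exact: open_nbhs_nbhs.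
Qed.

Section Recurrence.
Variable X : topologicalType.
Hypotheses (X_compact : compact [set: X]) (X_hausdorff : hausdorff_space X).

Lemma ptws_compact : compact [set: {ptws X -> X}].
Proof.
have := @tychonoff X (fun=> X) (fun=> setT) (fun=> X_compact).
by rewrite (_ : [set f | _] = setT) //; apply/seteqP; split.
Qed.

Lemma ptws_hausdorff : hausdorff_space {ptws X -> X}.
Proof. exact: (@hausdorff_product X (fun=> X) (fun=> X_hausdorff)). Qed.

Variable f : X -> X.
Hypothesis f_continuous : continuous f.
(** Only positive iterates appear, so that a distal homeomorphism and its inverse both qualify. *)
Hypothesis f_distal : forall x y z : X,
  (forall U, nbhs z U -> exists n, U (iter n.+1 f x) /\ U (iter n.+1 f y)) ->
  x = y.

Lemma iter_continuous n : continuous (iter n f).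
Proof.
elim: n => [|n IHn] x /=; first exact: cvg_id.
by apply: (continuous_comp (IHn x)); exact: f_continuous.
Qed.

(* Ellis: an idempotent [u] in the closure of the iterates of [f] sends [x] and
   [u x] to the same point, so distality forces [u = id]. *)
Lemma distal_recurrent (x : X) (U : set X) :
  nbhs x U -> exists n, U (iter n.+1 f x).
Proof.
pose E : set {ptws X -> X} := 
    closure ([set iter n.+1 f | n in setT] : set {ptws X -> X}).
have evalc (y : X) : continuous (fun p : {ptws X -> X} => p y).
  exact: eval_ptws_continuous.
pose comp (p q : {ptws X -> X}) : {ptws X -> X} := p \o q.
have compr q : continuous (comp^~ q).
  by apply: ptws_continuous => y; exact: evalc.
have compl n : continuous (comp (iter n f)).
  apply: ptws_continuous => y p.
  by apply: (continuous_comp (evalc y p)); exact: iter_continuous.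
have cE : closed E by exact: closed_closure.
have Ei n : E (iter n.+1 f) by apply: subset_closure; exists n.
have [||u Eu uu] := @ellis_numakura _ comp
  ptws_compact ptws_hausdorff (fun _ _ _ => erefl) compr E cE.
- by exists (iter 1 f); exact: Ei.
- move=> p q Ep Eq.
  (* Right composition is always continuous, left composition by iterates of [f] is too; so the
     product is first treated for [p] an iterate, then for any [p] in [E]. *)
  have Eiq n : E (comp (iter n.+1 f) q).
    have : closed (comp (iter n.+1 f) @^-1` E).
      by apply: preimage_closed => // r _; exact: compl.
    apply; apply: (closureS _ Eq) => _ [k _ <-].
    apply: subset_closure; exists (n + k.+1)%N => //.
    by apply/funext => y; exact: (iterD n.+1 k.+1).
  have : closed (comp^~ q @^-1` E).
    by apply: preimage_closed => // r _; exact: compr.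
  by apply; apply: (closureS _ Ep) => _ [k _ <-]; exact: Eiq.
suff ux : u x = x.
  move=> xU; have xU' : nbhs u [set p : {ptws X -> X} | U (p x)].
    by apply: (evalc x u); rewrite ux.
  by have [_ [[n _ <-] Un]] := Eu _ xU'; exists n.
apply/esym/(f_distal (z := u x)) => V Vux.
have Vu (y : X) : u y = u x -> nbhs u [set p : {ptws X -> X} | V (p y)].
  by move=> uy; apply: (evalc y u); rewrite uy.
have uux : u (u x) = u x by rewrite -[in RHS]uu.
have [_ [[n _ <-] [Vx Vux']]] := Eu _ (filterI (Vu x erefl) (Vu (u x) uux)).
by exists n.
Qed.

End Recurrence.

Section Homeomorphisms.
Variable X : topologicalType.

(** Neighborhoods of a diagonal point [(z, z)] shrink to squares of neighborhoods of [z]. *)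
Lemma distalP (T : homeomorphism X) : distal T <-> forall x y z : X,
  (forall U, nbhs z U ->
    exists n, U (homeo_iter T n x) /\ U (homeo_iter T n y)) -> x = y.
Proof.
split=> [dT x y z xyz|dT x y xy].
  apply: contrapT => /dT; rewrite -subset0 => /(_ (z, z)); apply; split => // B.
  move=> [[P Q] /= [Pz Qz] PQB].
  have [n [Ux Uy]] := xyz _ (filterI Pz Qz).
  exists (homeo_iter T n x, homeo_iter T n y); split; first by exists n.
  by apply: PQB; split => /=; [case: Ux|case: Uy].
rewrite -subset0 => -[z z'] [/= clz zz']; subst z'; apply: xy.
apply: (dT x y z) => U Uz.
have [|_ [[n ->] [/= Ux Uy]]] := clz (U `*` U); first by exists (U, U).
by exists n.
Qed.

Lemma distal_iter_recurrent (T : homeomorphism X) (x : X) (U : set X) :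
  compact [set: X] -> hausdorff_space X -> distal T -> nbhs x U ->
  (exists n, U (iter n.+1 T x)) /\ (exists n, U (iter n.+1 (homeo_inv T) x)).
Proof.
move=> cX hX /distalP dT Ux; split; apply: distal_recurrent Ux => //.
- exact: homeo_continuous.
- move=> y y' z h; apply: (dT _ _ z) => V /h[n Vn].
  by exists (Posz n.+1).
- exact: homeo_inv_continuous.
- move=> y y' z h; apply: (dT _ _ z) => V /h[n Vn].
  by exists (Negz n).
Qed.

End Homeomorphisms.

Local Open Scope group_scope.

(** * Open subgroups of topological groups *)

Section TopologicalGroups.
Variable G : topologicalGroupType.
Implicit Types (x y z : G) (U V : set G).

Lemma mulg_cvg (I : Type) (F : set_system I) (f g : I -> G) x y :
  Filter F -> f @ F --> x -> g @ F --> y -> (fun i => f i * g i) @ F --> x * y.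
Proof.
move=> FF; apply: (@continuous2_cvg I G G G F FF f g (fun x y => x * y) x y).
exact: (@mulg_continuous G (x, y)).
Qed.

Lemma invg_cvg (I : Type) (F : set_system I) (f : I -> G) x :
  Filter F -> f @ F --> x -> (fun i => (f i)^-1) @ F --> x^-1.
Proof. by move=> FF; apply: continuous_cvg; exact: invg_continuous. Qed.

Lemma mulg_continuousl x : continuous (fun y => x * y).
Proof. by move=> y; apply: mulg_cvg; [exact: cvg_cst|exact: cvg_id]. Qed.

Lemma nbhs_lcoset V x y :
  open V -> V (x^-1 * y) -> nbhs y [set z | V (x^-1 * z)].
Proof.
move=> oV Vxy; apply: (@mulg_continuousl x^-1 y).
exact: open_nbhs_nbhs.
Qed.

Lemma nbhs1_translate x U : nbhs x U -> nbhs 1 [set v | U (x * v)].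
Proof. by rewrite -{1}[x]mulg1; exact: mulg_continuousl. Qed.

Lemma open_subgroup_closed V : is_subgroup V -> open V -> closed V.
Proof.
move=> [V1 VM VV] oV x clx.
have [|v [Vv Vxv]] := clx [set z | V (x^-1 * z)].
  by apply: nbhs_lcoset => //; rewrite mulVg.
by have := VM _ _ Vv (VV _ Vxv); rewrite invgM invgK mulVKg.
Qed.

(** Van Dantzig's theorem. For a clopen [W] around [1] inside [U], the set [L] of the [x] with [x W]
    inside [W] is a neighborhood of [1] by compactness of [W]; the elements of [L] with inverse in
    [L] form the subgroup, contained in [W] since [1] is in [W]. *)
Lemma open_subgroup_base U : compact [set: G] -> hausdorff_space G ->
  totally_disconnected [set: G] -> nbhs 1 U ->
  exists V, [/\ is_subgroup V, open V & V `<=` U].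
Proof.
move=> cG hG tdG U1.
have [W [W1 [oW cW]] WU] := totally_disconnected_clopen_base cG hG tdG U1.
have Wnear : \forall x \near 1, W `<=` [set w | W (x * w)].
  have /compact_near_coveringP := closed_compact cG cW; apply => w Ww.
  have : (fun p : G * G => p.2 * p.1) @ (w, 1) --> (1 * w)%g.
    by apply: mulg_cvg; [exact: cvg_snd|exact: cvg_fst].
  by apply; rewrite mul1g; exact: open_nbhs_nbhs.
pose L := [set x | W `<=` [set w | W (x * w)]].
have LM x y : L x -> L y -> L (x * y).
  by move=> Lx Ly w /Ly/Lx; rewrite /= mulgA.
pose V := [set x | L x /\ L x^-1].
have V1 : nbhs 1 V.
  apply: filterI => //.
  by apply: (@invg_continuous G 1); rewrite invg1.
exists V; split.
- split.
  + exact: nbhs_singleton V1.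
  + by move=> x y [Lx Lx'] [Ly Ly']; split; rewrite ?invgM; exact: LM.
  + by move=> x [Lx Lx']; split; rewrite ?invgK.
- rewrite openE => x [Lx Lx'].
  have : nbhs x [set y | V (x^-1 * y)].
    by apply: (@mulg_continuousl x^-1 x); rewrite mulVg.
  apply: filterS => y [Lxy Lxy']; split.
    by rewrite -(mulVKg x y); exact: LM.
  by have := LM _ _ Lxy' Lx'; rewrite invgM invgK mulgK.
- by move=> x [Lx _]; apply: WU; have := Lx 1 W1; rewrite /= mulg1.
Qed.

End TopologicalGroups.

(** * Iterates and stabilizers of automorphisms *)

Section Automorphisms.
Variable G : topologicalGroupType.
Implicit Types (S T : topAut G) (V : set G).

Lemma aut_morph1 T : T 1 = 1.
Proof. by apply: (mulgI (T 1)); rewrite -autM !mulg1. Qed.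

Lemma aut_morphV T x : T x^-1 = (T x)^-1.
Proof. by apply: (mulgI (T x)); rewrite -autM !mulgV aut_morph1. Qed.

Lemma aut_morphVM T x y : T (x^-1 * y) = (T x)^-1 * T y.
Proof. by rewrite autM aut_morphV. Qed.

(** A single automorphism realizes the iterate on both spaces, so morphism properties apply to it;
    [K] records where it lives and is [setT] when only its existence matters. *)
Lemma homeo_iter_aut (K : set (topAut G)) T n : is_subgroup K -> K T ->
  exists S, [/\ K S, homeo_iter T n = S &
                homeo_iter (sub_homeo T) n = sub_image S].
Proof.
move=> [K1 KM KV] KT.
have iterS T' : K T' -> forall k, exists S, [/\ K S, iter k T' = S &
    iter k (sub_image T') = sub_image S].
  move=> KT'; elim=> [|k [S [KS /funeqP iS /funeqP iS']]].
    exists 1; split => //; apply/funext => A; apply: sub_inj.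
    by apply/esym; exact: image_id.
  exists (T' * S); split; first exact: KM.
    by apply/funext => x /=; rewrite iS.
  apply/funext => A /=; rewrite iS'; apply: sub_inj.
  by rewrite /= -image_comp.
case: n => n; first exact: iterS.
by have := iterS T^-1 (KV _ KT) n.+1.
Qed.

Definition invariant_open_subgroup T V :=
  [/\ is_subgroup V, open V & T @^-1` V = V].

Definition small_invariant_subgroups T := forall U, nbhs (1 : G) U ->
  exists2 V, invariant_open_subgroup T V & V `<=` U.

Lemma stabilizer_subgroup (P : set (set G)) :
  is_subgroup [set S : topAut G | forall V, P V -> S @^-1` V = V].
Proof.
split => [V //|S S' SP S'P V PV|S SP V PV].
  by rewrite -[RHS](S'P V PV) -{2}(SP V PV).
rewrite -[in LHS](SP V PV); apply/funext => x.
by rewrite /preimage /= (homeoVK S).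
Qed.

End Automorphisms.

(** * Invariant open subgroups of a distal automorphism *)

Section DistalAutomorphisms.
Variable G : topologicalGroupType.
Hypotheses (G_hausdorff : hausdorff_space G) (G_compact : compact [set: G]).
Hypothesis G_totally_disconnected : totally_disconnected [set: G].
Variable T : topAut G.

(* With [C N = \bigcap_(1 <= j <= N) T^-j W], recurrence gives
   [\bigcap_N C N `<=` W], so [C N `<=` W] for some [N] by compactness.  Then
   [T^-1] maps [C N] into itself, and onto itself by recurrence again. *)
Lemma distal_small_invariant_subgroups :
  distal T -> small_invariant_subgroups T.
Proof.
move=> dT U U1.
have rec x A := @distal_iter_recurrent G T x A G_compact G_hausdorff dT.
have [W [sW oW WU]] :=
  open_subgroup_base G_compact G_hausdorff G_totally_disconnected U1.
have cW := open_subgroup_closed sW oW.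
have [W1 WM WV] := sW.
pose C N := [set x | forall j, (j < N)%N -> W (iter j.+1 T x)].
have iterc n : continuous (iter n T).
  exact/iter_continuous/homeo_continuous.
have oC N : open (C N).
  elim: N => [|N IHN].
    by rewrite (_ : C 0%N = setT); [exact: openT|apply/seteqP; split].
  rewrite (_ : C N.+1 = C N `&` iter N.+1 T @^-1` W).
    by apply: openI => //; apply: open_comp => // x _; exact: iterc.
  apply/seteqP; split => [x Cx|x [Cx Wx] j].
    by split => [j jN|]; apply: Cx => //; exact: ltnW.
  by rewrite ltnS leq_eqVlt => /predU1P[->|/Cx].
have cC N : closed (C N).
  have -> : C N = \bigcap_(j in [set j | (j < N)%N]) iter j.+1 T @^-1` W by [].
  by apply: closed_bigI => j _; apply: preimage_closed => // x _; exact: iterc.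
have sC N : is_subgroup (C N).
  have iterE j : exists S : topAut G, iter j T = S.
    have [//|//|S [_ iS _]] := @homeo_iter_aut G setT T (Posz j).
    by exists S.
  split => [j _|x y Cx Cy j jN|x Cx j jN].
  - by have [S ->] := iterE j.+1; rewrite aut_morph1.
  - have := WM _ _ (Cx j jN) (Cy j jN).
    by have [S ->] := iterE j.+1; rewrite autM.
  - have := WV _ (Cx j jN).
    by have [S ->] := iterE j.+1; rewrite aut_morphV.
have [_ [N _ <-] CW] : exists2 D, [set C N | N in setT] D & D `<=` W.
  apply: compact_directed_sub_open => //.
  - by exists (C 0%N), 0%N.
  - move=> _ _ [M _ <-] [N _ <-].
    exists (C (maxn M N)); first by exists (maxn M N).
    by move=> x Cx; split => j jN; apply: Cx; rewrite leq_max jN ?orbT.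
  - by move=> _ [N _ <-].
  (* A point outside [W] but in every [C N] would never return to the open complement of [W]. *)
  - move=> x Cx; apply: contrapT => nWx.
    have [|[n nWn] _] := rec x (~` W).
      by apply: open_nbhs_nbhs; split => //; exact: closed_openC.
    by apply: nWn; apply: (Cx (C n.+1)) (ltnSn n); exists n.+1.
have CT x : C N (T x) -> C N x.
  move=> CTx [_|j jN]; first exact: CW.
  by have := CTx j (ltnW jN); rewrite -iterSr.
exists (C N); last by move=> x /CW/WU.
split => //; apply/seteqP; split => [x /CT//|x Cx].
(* The backward orbit of [T x] returns to the complement of [C N] after [n.+1] steps, that is at
   [T^-n x], which lies in [C N] since [T^-1] maps [C N] into itself. *)
apply: contrapT => nCTx.
have [|_ [n]] := rec (T x) (~` C N).
  by apply: open_nbhs_nbhs; split => //; exact: closed_openC.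
apply; rewrite iterSr homeoK; elim: n => //= n IHn.
by apply: CT; rewrite homeoVK.
Qed.

End DistalAutomorphisms.

(** * Neighborhoods in the Chabauty topology *)

Section ChabautyNeighborhoods.
Variable G : topologicalGroupType.
Hypotheses (G_hausdorff : hausdorff_space G) (G_compact : compact [set: G]).
Implicit Types A C D : closed_subgroup G.

Lemma chabauty_cvg (F : set_system (closed_subgroup G)) C : Filter F ->
  (forall W, chabauty_subbase W -> W C -> F W) -> F --> C.
Proof.
move=> FF FW U; rewrite nbhsE => -[_ [[D sD <-] [W DW WC]] WU].
have [E sE EW] := sD _ DW.
suff : F W by apply: filterS => z Wz; apply: WU; exists W.
rewrite -EW in WC *; apply: filter_bigI => V VE; apply: FW; last exact: WC.
by have := sE _ VE; rewrite inE.
Qed.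

Lemma trivial_subgroup : is_subgroup [set (1 : G)].
Proof. by split => [|x y -> ->|x ->] //=; rewrite ?mulg1 ?invg1. Qed.

Lemma closed_set1 (x : G) : closed [set x].
Proof. exact/accessible_closed_set1/hausdorff_accessible. Qed.

Definition trivial_closed_subgroup : closed_subgroup G :=
  ClosedSubgroup trivial_subgroup (@closed_set1 1).

(** Every subgroup contains [1], so the conditions of meeting an open set hold automatically; those
    of missing a compact set amount to lying in its complement. *)
Lemma nbhs_trivial_closed_subgroup (U : set (closed_subgroup G)) :
  nbhs trivial_closed_subgroup U ->
  exists2 V : set G, nbhs 1 V & forall A, A `<=` V -> U A.
Proof.
pose F := filter_from (nbhs (1 : G))
  (fun V => [set A : closed_subgroup G | A `<=` V]).
have FF : Filter F.
  apply: filter_from_filter; first by exists setT; exact: filterT.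
  move=> V W V1 W1; exists (V `&` W); first exact: filterI.
  by move=> A /= AVW; split => x /AVW[].
move=> U1; suff /(_ U U1)[V V1 VU] : F --> trivial_closed_subgroup by exists V.
apply: chabauty_cvg => _ [[K /= cK <-] /= K1|[O /= oO <-] [x [/= -> O1]]].
  exists (~` K) => [|A AK]; last exact/disjoints_subset.
  apply: open_nbhs_nbhs; split.
    by apply: closed_openC; exact: compact_closed.
  by move=> K1'; rewrite -[False]/(set0 (1 : G)) -K1.
exists setT => [|A _]; first exact: filterT.
by exists 1; split => //; have [] := sub_subgroup A.
Qed.

Definition mul_set (A V : set G) : set G :=
  [set x | exists2 a, A a & V (a^-1 * x)].

Lemma mul_set_open A V : open V -> open (mul_set A V).
Proof.
move=> oV; rewrite openE => x [a Aa Vax].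
by have := nbhs_lcoset oV Vax; apply: filterS => y Vay; exists a.
Qed.

Lemma mul_set_sub (A B V : set G) : is_subgroup V ->
  A `<=` mul_set B V -> mul_set A V `<=` mul_set B V.
Proof.
move=> [_ VM _] AB x [a /AB[b Bb Vba] Vax]; exists b => //.
by have := VM _ _ Vba Vax; rewrite -mulgA mulVKg.
Qed.

Lemma sub_mul_set (A V : set G) : is_subgroup V -> A `<=` mul_set A V.
Proof. by move=> [V1 _ _] x Ax; exists x => //; rewrite mulVg. Qed.

(** [D] lies in [C V] once it misses the compact complement of [C V]. Conversely, finitely many
    cosets [c V] cover the compact [C], which lies in [D V] once [D] meets each of them. *)
Lemma nbhs_mul_set C V : is_subgroup V -> open V ->
  nbhs C [set D | mul_set D V = mul_set C V].
Proof.
move=> sV oV; have [V1 VM VV] := sV.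
have DC : \forall D \near C, sub_set D `<=` mul_set C V.
  have : nbhs C [set D | sub_set D `&` ~` mul_set C V = set0].
    apply: open_nbhs_nbhs; split.
      apply: chabauty_open; left; exists (~` mul_set C V) => //.
      exact/(closed_compact G_compact)/open_closedC/mul_set_open.
    apply/disjoints_subset; rewrite setCK; exact: sub_mul_set.
  by apply: filterS => D /disjoints_subset; rewrite setCK.
have CD : \forall D \near nbhs C, C `<=` mul_set (sub_set D) V.
  have /compact_near_coveringP := closed_compact G_compact (@sub_closed G C).
  apply => c Cc; exists ([set y | V (c^-1 * y)],
      [set D | sub_set D `&` [set y | V (c^-1 * y)] !=set0]).
    split => /=; first by apply: nbhs_lcoset; rewrite ?mulVg.
    apply: open_nbhs_nbhs; split.
      apply: chabauty_open; right; exists [set y | V (c^-1 * y)] => //=.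
      rewrite openE => y; exact: nbhs_lcoset.
    by exists c; split => //=; rewrite mulVg.
  move=> [c' D] /= [Vcc' [d [Dd Vcd]]]; exists d => //.
  by have := VM _ _ (VV _ Vcd) Vcc'; rewrite invgM invgK -mulgA mulVKg.
apply: filterS2 DC CD => D DC CD.
by apply/seteqP; split; exact: mul_set_sub.
Qed.

End ChabautyNeighborhoods.

(** * Convergence of automorphisms in the compact-open topology *)

Lemma topAut_cvgP (G : topologicalGroupType) (F : set_system (topAut G))
    (S : topAut G) : Filter F ->
  F --> S <-> forall K O, compact K -> open O -> S @` K `<=` O ->
    F [set S' : topAut G | S' @` K `<=` O].
Proof.
move=> FF; pose c (S : topAut G) : {compact-open, G -> G} := S.
have -> : (F --> S) <-> (c @ F --> c S).
  split=> [FS|cFS].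
    have cS : c @ nbhs S --> c S by exact: initial_continuous.
    exact: cvg_trans (cvg_app c FS) cS.
  move=> U [_ [[V oV <-] VS] VU].
  suff : F (c @^-1` V) by apply: filterS.
  by apply: cFS; exact: open_nbhs_nbhs.
exact: compact_open_cvgP.
Qed.

Lemma topAut_eval_continuous (G : topologicalGroupType) (x : G) :
  continuous (fun S : topAut G => S x).
Proof.
move=> S U; rewrite nbhsE => -[V [oV VSx] VU].
have /topAut_cvgP/(_ [set x] V (@compact_set1 _ x) oV) : nbhs S --> S by [].
have VS : S @` [set x] `<=` V by move=> _ [_ -> <-].
move=> /(_ VS); apply: filterS => S' S'V.
by apply: VU; apply: S'V; exists x.
Qed.

(** * Distality on the group and on its closed subgroups *)

Section DistalityOfActions.
Variable G : topologicalGroupType.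
Hypotheses (G_hausdorff : hausdorff_space G) (G_compact : compact [set: G]).
Variable T : topAut G.

(** If [x] lies in [a V], then [a] lies in [x V], so points of [A] come arbitrarily close to [x]. *)
Lemma closed_subgroup_mul_set (A : closed_subgroup G) x :
  (forall V, invariant_open_subgroup T V -> mul_set A V x) ->
  small_invariant_subgroups T -> sub_set A x.
Proof.
move=> AV sT; apply: sub_closed => U /nbhs1_translate/sT[V VT VU].
have [[_ _ VV] _ _] := VT.
have [a Aa Vax] := AV V VT; exists a; split => //.
by have := VU _ (VV _ Vax); rewrite /= invgM invgK mulVKg.
Qed.

Lemma mul_set_preimage (S : topAut G) (A : closed_subgroup G) V :
  S @^-1` V = V -> S @^-1` mul_set (sub_image S A) V = mul_set A V.
Proof.
move=> SV; apply/seteqP; split => [x [_ [a Aa <-]]|x [a Aa Vax]].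
  rewrite -aut_morphVM => Vax; exists a => //.
  by rewrite -SV.
exists (S a); first by exists a.
by rewrite -aut_morphVM -[V _]/((S @^-1` V) _) SV.
Qed.

(** When [T^n A] and [T^n B] are both close to [C], multiplying either by [V] gives [C V]; since
    [T^n] preserves [V], pulling back yields [A V = B V]. *)
Lemma distal_sub_homeo : small_invariant_subgroups T -> distal (sub_homeo T).
Proof.
move=> sT; apply/distalP => A B C ABC.
have AB V : invariant_open_subgroup T V -> mul_set A V = mul_set B V.
  move=> VT; have [sV oV TV] := VT.
  have [n] := ABC _ (nbhs_mul_set G_compact C sV oV).
  have TstabV W : [set V] W -> T @^-1` W = W by move=> ->.
  have [S [SV _ ->]] :=
    @homeo_iter_aut G _ T n (@stabilizer_subgroup G [set V]) TstabV.
  move=> [/= SA SB]; have {}SV := SV V erefl.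
  by rewrite -(mul_set_preimage A SV) SA -SB mul_set_preimage.
apply: sub_inj; apply/seteqP; split => x Ax.
  apply: closed_subgroup_mul_set => // V VT; rewrite -(AB _ VT).
  by apply: sub_mul_set => //; case: VT.
apply: closed_subgroup_mul_set => // V VT; rewrite (AB _ VT).
by apply: sub_mul_set => //; case: VT.
Qed.

Definition closed_subgroup_gen_set (x : G) : set G :=
  \bigcap_(A in [set A : set G | [/\ is_subgroup A, closed A & A x]]) A.

Lemma closed_subgroup_gen_subgroup x :
  is_subgroup (closed_subgroup_gen_set x).
Proof.
split => [A [[]]//|y z gy gz A gA|y gy A gA]; have [[_ AM AV] _ _] := gA.
  by apply: AM; [exact: gy|exact: gz].
by apply: AV; exact: gy.
Qed.

Lemma closed_subgroup_gen_closed x : closed (closed_subgroup_gen_set x).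
Proof. by apply: closed_bigI => A []. Qed.

Definition closed_subgroup_gen x : closed_subgroup G :=
  ClosedSubgroup (closed_subgroup_gen_subgroup x)
    (@closed_subgroup_gen_closed x).

(* The closed subgroup generated by [w] shrinks to [{1}] along any iterates of
   [T] that bring [w] close to [1]. *)
Lemma distal_of_sub_homeo : totally_disconnected [set: G] ->
  distal (sub_homeo T) -> distal T.
Proof.
move=> tdG /distalP dT; apply/distalP => x y z xyz.
pose w := x^-1 * y.
have w1 U : nbhs 1 U -> exists n, U (homeo_iter T n w).
  move=> U1.
  (* [T^n w] is the quotient of [T^n x] and [T^n y], hence close to [z^-1 z = 1] when both are close
     to [z]. *)
  have : nbhs (z, z) [set p : G * G | U (p.1^-1 * p.2)].
    have : (fun p : G * G => p.1^-1 * p.2) @ (z, z) --> (z^-1 * z)%g.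
      by apply: mulg_cvg; [apply: invg_cvg; exact: cvg_fst|exact: cvg_snd].
    by apply; rewrite mulVg.
  move=> [[P Q] [/= Pz Qz] PQU].
  have [n [[Px Qx] [Py Qy]]] := xyz _ (filterI Pz Qz).
  exists n; have [//|//|S [_ TS _]] := @homeo_iter_aut G setT T n.
  by rewrite /w TS aut_morphVM -TS; exact: (PQU (_, _)).
suff : w = 1 by move=> w_1; rewrite -[y](mulVKg x) -/w w_1 mulg1.
suff wtriv : closed_subgroup_gen w = trivial_closed_subgroup G_hausdorff.
  have : sub_set (closed_subgroup_gen w) w by move=> A [].
  by rewrite wtriv.
apply: (dT _ _ (trivial_closed_subgroup G_hausdorff)) => U.
move=> /nbhs_trivial_closed_subgroup[V V1 VU].
have [W [sW oW WV]] := open_subgroup_base G_compact G_hausdorff tdG V1.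
have [W1 _ _] := sW.
have [n Ww] := w1 W (open_nbhs_nbhs (conj oW W1)).
have [//|//|S [_ TS TS']] := @homeo_iter_aut G setT T n.
exists n; rewrite TS'; split; apply: VU; apply: subset_trans WV.
  (* The preimage of [W] is a closed subgroup containing [w], hence everything [w] generates. *)
  move=> _ [v genv <-]; apply: (genv (S @^-1` W)); split.
  - split => [|a b Wa Wb|a Wa]; rewrite /preimage /=.
    + by rewrite aut_morph1.
    + by rewrite autM; have [_ + _] := sW; exact.
    + by rewrite aut_morphV; have [_ _] := sW; exact.
  - apply: preimage_closed; first by move=> ? _; exact: homeo_continuous.
    exact: open_subgroup_closed.
  - by rewrite /preimage /= -TS.
by move=> _ [_ -> <-]; rewrite aut_morph1.
Qed.

(* A cluster point in [K] of the iterates of [T] identifies the two points. *)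
Lemma distal_of_compact_subgroup (K : set (topAut G)) :
  is_subgroup K -> compact K -> K T -> distal T.
Proof.
move=> sK cK KT; apply/distalP => x y z xyz.
(* Members of [K] bringing both [x] and [y] close to [z]; the iterates of [T] make this filter
   proper. *)
pose F := filter_from (nbhs z)
  (fun U => [set S : topAut G | [/\ K S, U (S x) & U (S y)]]).
have FF : ProperFilter F.
  apply: filter_from_proper => [|U /xyz[n [Ux Uy]]]; last first.
    have [S [KS TS _]] := homeo_iter_aut n sK KT.
    by exists S; split; rewrite // -TS.
  apply: filter_from_filter; first by exists setT; exact: filterT.
  move=> U V Uz Vz; exists (U `&` V); first exact: filterI.
  by move=> S [KS [Ux Vx] [Uy Vy]].
have FK : F K by exists setT; [exact: filterT|move=> S []].
have [S [KS clS]] := cK F FF FK.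
have evalE u :
    (forall U, nbhs z U -> F [set S : topAut G | U (S u)]) -> S u = z.
  move=> Fu; apply: G_hausdorff => A B Au Bz.
  have Su : nbhs S [set S' : topAut G | A (S' u)].
    exact: topAut_eval_continuous.
  have [S' [/= BS' AS']] := clS _ _ (Fu B Bz) Su.
  by exists (S' u).
apply: (can_inj (homeoK S)); rewrite !evalE // => U Uz.
  by exists U => // S' [].
by exists U => // S' [].
Qed.

End DistalityOfActions.

(** * Compactness of stabilizers of open subgroups *)

Lemma ultra_cvg (I : Type) (X : topologicalType) (F : set_system I)
    (h : I -> X) :
  compact [set: X] -> UltraFilter F -> exists x : X, h @ F --> x.
Proof.
move=> cX FU; have [x [_ clx]] := cX (h @ F) _ filterT.
exists x => U Ux; have [//|FnU] := in_ultra_setVsetC (h @^-1` U) FU.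
by have [y []] := clx (~` U) U FnU Ux.
Qed.

Section StabilizerCompact.
Variable G : topologicalGroupType.
Hypotheses (G_hausdorff : hausdorff_space G) (G_compact : compact [set: G]).
Variable P : set (set G).
Hypothesis P_open_subgroup : forall V, P V -> is_subgroup V /\ open V.
Hypothesis P_base : forall U, nbhs (1 : G) U -> exists2 V, P V & V `<=` U.

Let stab := [set S : topAut G | forall V, P V -> S @^-1` V = V].

Let P_base_at (x : G) U : nbhs x U ->
  exists2 V, P V & forall y, V (x^-1 * y) -> U y.
Proof.
move=> /nbhs1_translate/P_base[V PV VU]; exists V => // y /VU.
by rewrite /= mulVKg.
Qed.

Let P_nbhs (x : G) V : P V -> nbhs x [set y | V (x^-1 * y)].
Proof.
by move=> /P_open_subgroup[[V1 _ _] oV]; apply: nbhs_lcoset; rewrite ?mulVg.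
Qed.

Let P_separated (x y : G) : (forall V, P V -> V (x^-1 * y)) -> x = y.
Proof.
move=> xy; apply: G_hausdorff => A B /P_base_at[V PV VA] By.
by exists y; split; [apply: VA; exact: xy|exact: nbhs_singleton].
Qed.

Let P_continuous (f : G -> G) : {morph f : x y / x * y} ->
  (forall V x, P V -> V x -> V (f x)) -> continuous f.
Proof.
move=> fM fP x U /P_base_at[V PV VU].
apply: filterS (P_nbhs x PV) => y Vxy; apply: VU.
have -> : (f x)^-1 * f y = f (x^-1 * y).
  by apply: (mulgI (f x)); rewrite -fM !mulVKg.
exact: fP.
Qed.

(* Along an ultrafilter on the stabilizer, [S] and [S^-1] converge pointwise;
   since every [S] preserves each [V] in [P], the limits are mutually inverse
   automorphisms and the convergence is uniform. *)
Lemma stabilizer_compact : compact stab.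
Proof.
rewrite compact_ultra => F FU Fstab.
have limM (h : topAut G -> topAut G) (f : G -> G) :
    (forall x, (fun S => h S x) @ F --> f x) -> {morph f : x y / x * y}.
  move=> hf x y; apply: (cvg_unique G_hausdorff (hf (x * y))).
  have -> : (fun S => h S (x * y)) = (fun S => h S x * h S y).
    by apply/funext => S; rewrite autM.
  by apply: mulg_cvg; exact: hf.
(* Open subgroups are closed, so membership in [V] passes to limits. *)
have limV (h : topAut G -> G) x V : P V -> h @ F --> x ->
    F [set S | V (h S)] -> V x.
  move=> PV hx FV; have [sV oV] := P_open_subgroup PV.
  exact: (closed_cvg _ (open_subgroup_closed sV oV) FV _ hx).
have stabV S V x : stab S -> P V -> V (S x) = V x.
  by move=> + PV => /(_ V PV) SV; rewrite -{2}SV.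
have stabVV S V x : stab S -> P V -> V (S^-1 x) = V x.
  by move=> SK PV; rewrite -(stabV S) // [S _](homeoVK S).
have [f fE] := choice (fun x =>
  @ultra_cvg _ _ F (fun S : topAut G => S x) G_compact FU).
have [g gE] := choice (fun x =>
  @ultra_cvg _ _ F (fun S : topAut G => S^-1 x) G_compact FU).
have fM := limM id f fE; have gM := limM (fun S => S^-1) g gE.
have fV V x : P V -> V x -> V (f x).
  move=> PV Vx; apply: (limV _ _ _ PV (fE x)).
  by apply: filterS Fstab => S SK /=; rewrite stabV.
have gV V x : P V -> V x -> V (g x).
  move=> PV Vx; apply: (limV _ _ _ PV (gE x)).
  by apply: filterS Fstab => S SK /=; rewrite stabVV.
have mulr_cvg (h : topAut G -> G) y x : h @ F --> y ->
    (fun S => (h S)^-1 * x) @ F --> y^-1 * x.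
  by move=> hy; apply: mulg_cvg; [exact: invg_cvg|exact: cvg_cst].
have near_lim (h : topAut G -> G) x V : P V -> h @ F --> x ->
    F [set S | V (x^-1 * h S)].
  by move=> PV hx; exact: (hx _ (P_nbhs x PV)).
have fgK : cancel f g.
  move=> x; apply: P_separated => V PV.
  have := limV _ _ _ PV (mulr_cvg (fun S => S^-1 (f x)) _ x (gE (f x))).
  apply.
  (* Applying [S^-1] to [f(x)^-1 S(x)], which is eventually in [V], gives the quotient of
     [S^-1(f x)] and [x]. *)
  apply: filterS2 Fstab (near_lim _ _ _ PV (fE x)) => S SK /=.
  by rewrite -(stabVV S) // aut_morphVM [S^-1 (S x)](homeoK S).
have gfK : cancel g f.
  move=> x; apply: P_separated => V PV.
  have := limV _ _ _ PV (mulr_cvg (fun S : topAut G => S (g x)) _ x (fE (g x))).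
  apply.
  apply: filterS2 Fstab (near_lim _ _ _ PV (gE x)) => S SK /=.
  by rewrite -(stabV S) // aut_morphVM [S (S^-1 x)](homeoVK S).
pose S0 : topAut G := @TopAut G (Homeomorphism fgK gfK
  (P_continuous fM fV) (P_continuous gM gV)) fM.
exists S0; split.
  move=> V PV; apply/seteqP; split => x; last exact: (fV).
  by move=> /(gV _ _ PV); rewrite /= fgK.
apply/topAut_cvgP => K O cK oO S0KO.
(* Compactness of [K] reduces the claim to one near each [x] in [K]. *)
have /compact_near_coveringP := cK.
move=> /(_ _ F (fun S x => O (S x)) _) h.
suff : \forall S \near F, K `<=` (fun x => O ((S : topAut G) x)).
  by apply: filterS => S SKO _ [x Kx <-]; exact: SKO.
apply: h => x Kx.
have /P_base_at[V PV VO] : nbhs (f x) O.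
  by apply: open_nbhs_nbhs; split => //; apply: S0KO; exists x.
exists ([set y | V (x^-1 * y)],
        stab `&` [set S : topAut G | V ((f x)^-1 * S x)]).
  split; first exact: P_nbhs.
  by apply: filterI => //; exact: near_lim (fE x).
move=> [y S] /= [Vxy [SK VSx]]; apply: VO.
have [[_ VM _] _] := P_open_subgroup PV.
(* [f(x)^-1 S(y)] is the product of [f(x)^-1 S(x)] and [S(x^-1 y)], both in [V]. *)
rewrite -(mulVKg (S x) (S y)) mulgA; apply: VM => //.
by rewrite -aut_morphVM stabV.
Qed.

End StabilizerCompact.

Theorem proposition4p3 (G : topologicalGroupType)
    (G_hausdorff : hausdorff_space G)
    (G_compact : compact [set: G])
    (G_totally_disconnected : totally_disconnected [set: G])
    (G_first_countable : first_countable G)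
    (T : topAut G) :
  [<-> (* (1) *) distal T;
       (* (2) *) distal (sub_homeo T);
       (* (3) *) exists K : set (topAut G),
                   [/\ is_subgroup K, compact K & K T]].
Proof.
tfae.
- move=> dT; apply: distal_sub_homeo => //.
  exact: distal_small_invariant_subgroups.
(* Distality on [G] comes first: compactness of the stabilizer rests on the invariant open subgroups
   forming a base at [1]. *)
- move=> /(distal_of_sub_homeo G_hausdorff G_compact G_totally_disconnected) dT.
  exists [set S : topAut G |
    forall V, invariant_open_subgroup T V -> S @^-1` V = V]; split.
  + exact: stabilizer_subgroup.
  + apply: stabilizer_compact => //; first by move=> V [].
    exact: distal_small_invariant_subgroups.
  + by move=> V [].
- by move=> [K [sK cK KT]]; exact: distal_of_compact_subgroup KT.
Qed.
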